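(* Let $\mathbb{F}$ be a finite field of order $q$, let $k$ be a positive integer, and let $n=\mathrm{tower}(q,q,k,6)=q^{q^{k^{6}}}$. Then no excluded minor for the class of $\mathbb{F}$-representable matroids admits a sequence of $n$ nested $k$-separations.
   Context: For a (finite) matroid $M$ with rank function $r_M$ and $X\subseteq E(M)$, let $\lambda_M(X)=r_M(X)+r_M(E(M)-X)-r_M(E(M))$. A $k$-separation of $M$ is a partition $(A,B)$ of $E(M)$ such that $|A|,|B|\ge k$ and $\lambda_M(A)<k$. A sequence $(A_1,B_1),\ldots,(A_n,B_n)$ of $k$-separations of $M$ is nested if $A_1\subset A_2\subset\cdots\subset A_n$ (proper inclusions). An excluded minor for a minor-closed class of matroids is a matroid not in the class all of whose proper minors are in the class. $\mathrm{tower}(a_1,\ldots,a_n)=a_1^{a_2^{\cdot^{\cdot^{a_n}}}}$ (iterated exponentiation, evaluated from the top). *)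

(* Defs.v *)
From mathcomp Require Import all_boot all_algebra.

Set Implicit Arguments.
Unset Strict Implicit.
Unset Printing Implicit Defensive.

(* A finite matroid, given by its rank function, whose ground set is a subset
   of a finite type T, so that the minors of a matroid on T are again matroids
   on T. The rank function is extended to all subsets of T, the elements
   outside the ground set contributing nothing: the three axioms imply
   [rank X = rank (X :&: ground)], and on subsets of the ground set they are
   the usual rank axioms. *)
Record matroid (T : finType) := Matroid {
  ground : {set T};
  rank : {set T} -> nat;
  rank_le_card : forall X : {set T}, rank X <= #|X :&: ground|;
  rank_mono : forall X Y : {set T}, X \subset Y -> rank X <= rank Y;
  rank_submod : forall X Y : {set T},
    rank (X :|: Y) + rank (X :&: Y) <= rank X + rank Y }.

Section Minors.

Variables (T : finType) (M : matroid T).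
Implicit Types C D X Y : {set T}.

Definition delete_rank D X := rank M (X :\: D).

Lemma delete_rank_le_card D X :
  delete_rank D X <= #|X :&: (ground M :\: D)|.
Proof. by rewrite setIDA -setIDAC; exact: rank_le_card. Qed.

Lemma delete_rank_mono D X Y :
  X \subset Y -> delete_rank D X <= delete_rank D Y.
Proof. by move=> sXY; apply: rank_mono; exact: setSD. Qed.

Lemma delete_rank_submod D X Y :
  delete_rank D (X :|: Y) + delete_rank D (X :&: Y)
    <= delete_rank D X + delete_rank D Y.
Proof.
by rewrite /delete_rank setDUl setDIl; exact: rank_submod.
Qed.

Definition delete D : matroid T :=
  Matroid (delete_rank_le_card D) (@delete_rank_mono D)
    (delete_rank_submod D).

(* The subtraction is not truncated, by monotonicity of the rank. *)
Definition contract_rank C X := rank M (X :|: C) - rank M C.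

Lemma contract_rankK C X :
  contract_rank C X + rank M C = rank M (X :|: C).
Proof. by rewrite subnK // rank_mono // subsetUr. Qed.

Lemma contract_rank_le_card C X :
  contract_rank C X <= #|X :&: (ground M :\: C)|.
Proof.
rewrite leq_subLR addnC setIDA -setIDAC.
have -> : X :|: C = (X :\: C) :|: C.
  by apply/setP=> x; rewrite !inE; case: (x \in C); rewrite ?orbT ?orbF.
apply: leq_trans (leq_add (rank_le_card M (X :\: C)) (leqnn (rank M C))).
exact: leq_trans (leq_addr _ _) (rank_submod M _ _).
Qed.

Lemma contract_rank_mono C X Y :
  X \subset Y -> contract_rank C X <= contract_rank C Y.
Proof. by move=> sXY; rewrite leq_sub2r // rank_mono // setSU. Qed.

Lemma contract_rank_submod C X Y :
  contract_rank C (X :|: Y) + contract_rank C (X :&: Y)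
    <= contract_rank C X + contract_rank C Y.
Proof.
rewrite -(leq_add2r (rank M C + rank M C)).
rewrite [leqLHS]addnACA [leqRHS]addnACA !contract_rankK setUUl setUIl.
exact: rank_submod.
Qed.

Definition contract C : matroid T :=
  Matroid (contract_rank_le_card C) (@contract_rank_mono C)
    (contract_rank_submod C).

End Minors.

Definition proper_minor (T : finType) (N M : matroid T) : Prop :=
  exists C D : {set T},
    [/\ C :|: D \subset ground M, [disjoint C & D], C :|: D != set0
      & N = delete (contract M C) D].

Definition excluded_minor (T : finType) (P : matroid T -> Prop)
    (M : matroid T) : Prop :=
  ~ P M /\ (forall N : matroid T, proper_minor N M -> P N).

(* The vectors v x, for x in the ground set, are the columns of a matrix over F
   whose vector matroid is M. *)
Definition representable (F : fieldType) (T : finType) (M : matroid T) : Prop :=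
  exists (m : nat) (v : T -> 'cV[F]_m),
    forall X : {set T}, X \subset ground M ->
      rank M X = \dim <<[seq v x | x in X]>>%VS.

(* By submodularity the subtraction is not truncated for X included in the
   ground set. *)
Definition connectivity (T : finType) (M : matroid T) (X : {set T}) : nat :=
  rank M X + rank M (ground M :\: X) - rank M (ground M).

Definition k_separation (T : finType) (M : matroid T) (k : nat)
    (AB : {set T} * {set T}) : bool :=
  [&& AB.1 :|: AB.2 == ground M, [disjoint AB.1 & AB.2],
      k <= #|AB.1|, k <= #|AB.2| & connectivity M AB.1 < k].

Definition nested_k_separations (T : finType) (M : matroid T) (k : nat)
    (s : seq ({set T} * {set T})) : bool :=
  all (k_separation M k) s &&
  sorted (fun AB CD : {set T} * {set T} => AB.1 \proper CD.1) s.

(* tower [:: a1; ...; an] = a1 ^ (a2 ^ (... ^ an)) *)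
Definition tower (s : seq nat) : nat := foldr expn 1 s.

(* Main.v *)
Require Import Defs.
From mathcomp Require Import all_boot all_algebra zify.
From HB Require Import structures.

(** Call two sets twins with respect to A when they have the same local
    connectivity with every subset of A. A representation of M with a
    separation (A, B) of connectivity t puts the spans of A and B in contact
    along a boundary W of dimension t, and the local connectivity of X and Y,
    for X in A and Y in B, is the dimension of the intersection of the traces
    of their spans on W. Conversely a representation of the A side and a
    representation of the B side amalgamate into a representation of M as soon
    as, for some identification of their boundaries, the traces have
    intersections of the right dimensions ([glue]).

    Let M be an excluded minor with a long nested sequence of k-separations.
    Pigeonholing on the connectivity of the sets in between gives a long chain
    A 0, ..., A m of sets of the same connectivity t < k such that no set
    between A 0 and A m has connectivity less than t ([tight_subchain]), and
    Tutte's linking theorem ([tutte_linking]) gives one set L between A 0 and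
    A m whose contraction carries the boundary at each A i onto the boundary
    at each other A j. Hence a set Y on the right of A j can be compared with
    sets on the right of an earlier A i: contracting the part of L between A i
    and A j amounts to replacing Y by its union with that part of L.

    The matroid M has no representation, yet sets on the right of A i fall,
    up to twins, into boundedly many classes: choose an element e on the right
    of the whole chain; a set without e is described by its trace in a
    representation of M \ e, and a set with e by its trace in a representation
    of M / e. These labels take finitely many values and are compatible with L
    ([element_labels]).

    Now let j < m. Shrinking the piece of the chain between A j and A (j + 1)
    to its part of L, which is contracted, leaves a proper minor of M, which
    has a representation R_j, with a boundary that is identified with F^t. The
    state of j is the set of all pairs (label of Y, trace of Y in R_j), for Y
    on the right of A (j + 1). If i < j have the same state, then the left side
    of A (i + 1), represented by R_j, and its right side, represented by R_i,
    amalgamate into a representation of M: each Y on the right of A (i + 1) has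
    the same label and the same trace as some Y' on the right of A (j + 1),
    and R_j knows how the subsets of A (i + 1) meet Y' ([equal_states_glue]).
    So the states are distinct and m is at most their number
    ([linked_chain_bound]), which is the exponential of a power of q because
    a state is a set of pairs of subspaces of F^t, up to one bit.

    For k = 1 and q = 2 this count exceeds the announced bound, but for k = 1 a
    single separation suffices: an excluded minor is connected. *)

Set Implicit Arguments.
Unset Strict Implicit.
Unset Printing Implicit Defensive.
Import GRing.Theory VectorInternalTheory.

(** * Linear algebra *)

HB.instance Definition _ (K : finFieldType) (vT : vectType K) :=
  [Countable of {vspace vT} by <:].
HB.instance Definition _ (K : finFieldType) (vT : vectType K) :=
  [Finite of {vspace vT} by <:].

Lemma card_vspace (K : finFieldType) (vT : vectType K) :
  #|{: {vspace vT}}| <= #|K| ^ (dim vT * dim vT).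
Proof.
rewrite -card_mx; exact: (leq_card val val_inj).
Qed.

Lemma ex_lfun (K : fieldType) (aT rT : vectType K) (f : aT -> rT) :
  linear f -> exists g : 'Hom(aT, rT), g =1 f.
Proof.
move=> linf; pose fL : {linear aT -> rT} :=
  HB.pack f (GRing.isLinear.Build K aT rT _ f linf).
by exists (linfun fL); exact: (lfunE fL).
Qed.

(** A frame of [W] is a surjection of the space of row vectors onto [W]: it
    gives coordinates in a space that does not depend on the representation,
    and subspaces of [W] are recovered from their preimages. *)
Lemma frame_exists (K : fieldType) (vT : vectType K) (W : {vspace vT}) t :
  \dim W <= t -> exists f : 'Hom('rV[K]_t, vT), limg f = W.
Proof.
move=> leWt.
have [|f fE] := @ex_lfun K 'rV[K]_t vT (fun r => \sum_(i < t) r 0%R i *: (vbasis W)`_i)%R.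
  move=> a u v; rewrite scaler_sumr -big_split /=; apply: eq_bigr => i _.
  by rewrite !mxE scalerDl scalerA.
exists f; apply/eqP; rewrite eqEsubv; apply/andP; split.
  apply/subvP=> w /memv_imgP[u _ ->]; rewrite fE; apply: memv_suml => i _.
  apply: memvZ; case: (ltnP i (\dim W)) => [lt_i|ge_i].
    by apply: vbasis_mem; rewrite mem_nth // size_tuple.
  by rewrite nth_default ?mem0v // size_tuple.
rewrite -{1}(span_basis (vbasisP W)); apply/span_subvP=> w /(nthP 0%R)[i].
rewrite size_tuple => lt_i <-.
pose i' := Ordinal (leq_trans lt_i leWt).
rewrite (_ : _`_i = f (delta_mx 0%R i'))%R ?memv_img ?memvf // fE.
rewrite (bigD1 i') //= big1 ?addr0 => [|j /negPf ne_ji]; rewrite !mxE ?eqxx ?scale1r //.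
by rewrite ne_ji scale0r.
Qed.

Lemma frame_inj (K : fieldType) (vT : vectType K) t (f : 'Hom('rV[K]_t, vT)) :
  \dim (limg f) = t -> lker f == 0%VS.
Proof.
move=> dimf; have := limg_ker_dim f fullv.
rewrite capfv dimf dimvf /dim /= -dimv_eq0.
rewrite mul1n; lia.
Qed.

Lemma preim_frame_dim (F : fieldType) (uT vT : vectType F) (f : 'Hom(uT, vT))
    (U V : {vspace vT}) :
  lker f == 0%VS -> (U :&: V <= limg f)%VS ->
  \dim ((f @^-1: U) :&: (f @^-1: V))%VS = \dim (U :&: V)%VS.
Proof.
move=> /eqP f0 sUV.
have -> : ((f @^-1: U) :&: (f @^-1: V) = f @^-1: (U :&: V))%VS.
  by apply/vspaceP=> w; rewrite memv_cap -!memv_preim memv_cap.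
by rewrite -[in RHS](lpreimK sUV) limg_dim_eq // f0 capv0.
Qed.

Lemma projection_along (F : fieldType) (vT : vectType F) (U : {vspace vT}) :
  exists p : 'End(vT), lker p = U.
Proof.
exists (\1%VF - projv U)%R; apply/vspaceP=> w.
rewrite memv_ker add_lfunE opp_lfunE id_lfunE subr_eq0.
by apply/eqP/idP=> [-> | /projv_id->//]; apply: memv_proj.
Qed.

(** * Local connectivity *)

Lemma subset_at (T : finType) (A B : {set T}) x :
  A \subset B -> (x \in A) ==> (x \in B).
Proof. by move/subsetP=> sAB; apply/implyP/sAB. Qed.

(** Boolean case analysis at a generic point, from the inclusions between sets
    that are in the context. *)
Ltac set_dec :=
  let x := fresh "x" in
  first [apply/setP=> x | apply/subsetP=> x; apply/implyP];
  repeat match goal with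
    H : is_true (_ \subset _) |- _ => move/(subset_at x): H end;
  rewrite ?inE;
  repeat match goal with
    |- context [x \in ?A] => case: (x \in A) => //=
  | |- context [x == ?A] => case: (x == A) => //=
  end.

Section Connectivity.
Variables (T : finType) (M : matroid T).
Implicit Types (X Y : {set T}).
Local Notation r := (rank M).

(** The dimension of the intersection of the spans, in a representation. *)
Definition lconn X Y := r X + r Y - r (X :|: Y).

Lemma lconnK X Y : lconn X Y + r (X :|: Y) = r X + r Y.
Proof. by rewrite subnK // (leq_trans _ (rank_submod M X Y)) // leq_addr. Qed.

Lemma lconnC X Y : lconn X Y = lconn Y X.
Proof. by rewrite /lconn addnC setUC. Qed.

Lemma lconnSl X X' Y : X \subset X' -> lconn X Y <= lconn X' Y.
Proof.
move=> sXX'; have := rank_submod M X' (X :|: Y).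
rewrite setUA (setUidPl sXX') => /(leq_trans _)-/(_ (r (X' :|: Y) + r X)).
rewrite leq_add2l rank_mono ?subsetI ?sXX' ?subsetUl // => /(_ isT).
have := lconnK X Y; have := lconnK X' Y; clear; lia.
Qed.

Lemma lconnS X X' Y Y' :
  X \subset X' -> Y \subset Y' -> lconn X Y <= lconn X' Y'.
Proof.
move=> sX sY; apply: leq_trans (lconnSl Y sX) _.
by rewrite ![lconn X' _]lconnC lconnSl.
Qed.

End Connectivity.

Section Skewness.
Variables (T : finType) (M : matroid T).
Implicit Types (X Y Z : {set T}).
Local Notation r := (rank M).

Lemma rank0 : r set0 = 0.
Proof. by apply/eqP; rewrite -leqn0 (leq_trans (rank_le_card _ _)) // set0I cards0. Qed.

Lemma rank_submodS X Y (I U : {set T}) : I \subset X :&: Y -> X :|: Y = U ->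
  r U + r I <= r X + r Y.
Proof.
by move=> sI <-; apply: leq_trans (rank_submod M X Y); rewrite leq_add2l rank_mono.
Qed.

(** The hypothesis says that contracting [Z] and contracting [A] have the same
    effect on [B]; then they have the same effect on all subsets of [B]. *)
Lemma lconn_inherit (Z A B B' : {set T}) : Z \subset A -> B' \subset B ->
  lconn M Z B = lconn M A B -> lconn M Z B' = lconn M A B'.
Proof.
move=> sZA sB'B eqB; apply/eqP; rewrite eqn_leq lconnSl //=.
have := @rank_submodS (A :|: B') (Z :|: B) (Z :|: B') (A :|: B).
have -> : Z :|: B' \subset (A :|: B') :&: (Z :|: B) by set_dec.
have -> : A :|: B' :|: (Z :|: B) = A :|: B by set_dec.
move=> /(_ isT erefl).
have := lconnK M Z B; have := lconnK M A B.
have := lconnK M Z B'; have := lconnK M A B'; move: eqB; clear; lia.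
Qed.

Definition twins (A Y1 Y2 : {set T}) :=
  forall X, X \subset A -> lconn M X Y1 = lconn M X Y2.

Lemma skew_rank (X Y X' Y' : {set T}) :
  lconn M X Y = 0 -> X' \subset X -> Y' \subset Y -> r (X' :|: Y') = r X' + r Y'.
Proof.
move=> XY0 sX sY; rewrite -lconnK; move: (lconnS M sX sY).
by rewrite XY0 leqn0 => /eqP->.
Qed.

End Skewness.

(** * Representations and amalgamation *)

Section Spans.
Variables (F : fieldType) (T : finType) (vT : vectType F) (v : T -> vT).
Implicit Types (X Y : {set T}).

Definition vspan X := <<[seq v x | x in X]>>%VS.

Lemma vspanP X (U : {vspace vT}) :
  reflect {in X, forall x, v x \in U} (vspan X <= U)%VS.
Proof.
apply: (iffP span_subvP) => [sXU x xX | vXU u /imageP[x xX ->]]; last exact: vXU.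
by apply: sXU; apply: image_f.
Qed.

Lemma mem_vspan X x : x \in X -> v x \in vspan X.
Proof. by move=> xX; apply/memv_span/image_f. Qed.

Lemma vspanS X Y : X \subset Y -> (vspan X <= vspan Y)%VS.
Proof. by move/subsetP=> sXY; apply/vspanP=> x /sXY/mem_vspan. Qed.

Lemma vspanU X Y : vspan (X :|: Y) = (vspan X + vspan Y)%VS.
Proof.
apply/eqP; rewrite eqEsubv subv_add !vspanS ?subsetUl ?subsetUr // !andbT.
apply/vspanP=> x /setUP[] /mem_vspan; apply: subvP.
  exact: addvSl.
exact: addvSr.
Qed.

End Spans.

Lemma limg_vspan (F : fieldType) (T : finType) (aT rT : vectType F)
    (f : 'Hom(aT, rT)) (v : T -> aT) (w : T -> rT) (X : {set T}) :
  {in X, forall x, w x = f (v x)} -> (f @: vspan v X)%VS = vspan w X.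
Proof.
move=> wE; rewrite limg_span -map_comp; congr span.
by apply/eq_in_map=> x; rewrite mem_enum /= => /wE.
Qed.

Section Representation.
Variables (F : fieldType) (T : finType).
Implicit Types (M : matroid T) (X Y : {set T}).

Definition represents (vT : vectType F) (v : T -> vT) M :=
  forall X, X \subset ground M -> rank M X = \dim (vspan v X).

Lemma represents_lconn (vT : vectType F) (v : T -> vT) M X Y :
    represents v M -> X \subset ground M -> Y \subset ground M ->
  lconn M X Y = \dim (vspan v X :&: vspan v Y)%VS.
Proof.
move=> vM sX sY; have := lconnK M X Y.
rewrite !vM ?subUset ?sX // vspanU -dimv_sum_cap; clear; lia.
Qed.

Lemma represents_representable (vT : vectType F) (v : T -> vT) M :
  represents v M -> representable F M.
Proof.
move=> vM; have [|f fE] := @ex_lfun F vT 'cV[F]_(dim vT) (fun u => (v2r u)^T)%R.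
  by move=> a x y; rewrite linearP linearD linearZ.
exists (dim vT), (f \o v) => X /vM->; rewrite -/(vspan _ X).
rewrite -(@limg_vspan _ _ _ _ f v) // limg_dim_eq //.
apply/eqP; rewrite -subv0; apply: subv_trans (capvSr _ _) _.
rewrite subv0; apply/lker0P=> x y; rewrite !fE => /trmx_inj; exact: v2r_inj.
Qed.

(** The frames [f1] and [f2] identify subspaces of the two representation
    spaces. Embed the second space into the product of both, by sending the
    image of [f2] to the image of [f1] and the rest to new dimensions: the two
    images then meet in the identified subspace only, so that the rank of a
    union is governed by the traces in the common frame. *)
Lemma glue (uT vT1 vT2 : vectType F) (v1 : T -> vT1) (v2 : T -> vT2)
    (f1 : 'Hom(uT, vT1)) (f2 : 'Hom(uT, vT2)) M (A B : {set T}) :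
    lker f1 == 0%VS -> lker f2 == 0%VS ->
    A :|: B = ground M -> [disjoint A & B] ->
    (forall X, X \subset A -> rank M X = \dim (vspan v1 X)) ->
    (forall Y, Y \subset B -> rank M Y = \dim (vspan v2 Y)) ->
    (forall X Y, X \subset A -> Y \subset B ->
       lconn M X Y =
         \dim ((f1 @^-1: vspan v1 X) :&: (f2 @^-1: vspan v2 Y))%VS) ->
  representable F M.
Proof.
move=> f1_inj f2_inj AB_M disAB v1A v2B ABconn.
have [|g1 g1E] := @ex_lfun F vT1 (vT1 * vT2)%type (fun x => (x, 0%R)).
  by move=> a x y; rewrite [RHS]surjective_pairing /= scaler0 addr0.
(* [f1 \o f2^-1] performs the identification; the second component vanishes
   exactly on the image of [f2]. *)
have [|g2 g2E] := @ex_lfun F vT2 (vT1 * vT2)%type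
    (fun y => (f1 ((f2^-1)%VF y), y - f2 ((f2^-1)%VF y))%R).
  move=> a x y; rewrite !linearP [RHS]surjective_pairing /=; congr pair.
  by rewrite scalerDr addrACA.
have g1_inj : lker g1 == 0%VS by apply/lker0P=> x y; rewrite !g1E => -[].
have g2_inj : lker g2 == 0%VS.
  apply/lker0P=> x y; rewrite !g2E => -[/(lker0P f1_inj)-> ].
  exact: addIr.
have g12 z : g2 (f2 z) = g1 (f1 z).
  by rewrite g1E g2E lker0_lfunK // subrr.
have inj_dim (aT rT : vectType F) (f : 'Hom(aT, rT)) U :
    lker f == 0%VS -> \dim (f @: U)%VS = \dim U.
  by move/eqP=> f0; rewrite limg_dim_eq // f0 capv0.
pose v x := if x \in A then g1 (v1 x) else g2 (v2 x).
apply: (@represents_representable _ v) => X sXM.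
set XA := X :&: A; set XB := X :&: B.
have defX : X = XA :|: XB by rewrite -setIUr AB_M; apply/esym/setIidPl.
have sXA : XA \subset A by apply: subsetIr.
have sXB : XB \subset B by apply: subsetIr.
have vXA : vspan v XA = (g1 @: vspan v1 XA)%VS.
  by apply/esym/limg_vspan=> x /(subsetP sXA); rewrite /v => ->.
have vXB : vspan v XB = (g2 @: vspan v2 XB)%VS.
  apply/esym/limg_vspan=> x /(subsetP sXB) xB; rewrite /v.
  by rewrite (disjointFl disAB xB).
have defI : (vspan v XA :&: vspan v XB =
    (g1 \o f1) @: ((f1 @^-1: vspan v1 XA) :&: (f2 @^-1: vspan v2 XB)))%VS.
  apply/vspaceP=> w; rewrite vXA vXB; apply/memv_capP/memv_imgP.
    case=> /memv_imgP[x xX ->] /memv_imgP[y yX].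
    rewrite g1E g2E => -[xE /esym/eqP]; rewrite subr_eq0 => /eqP yE.
    exists ((f2^-1)%VF y); last by rewrite comp_lfunE g1E xE.
    by rewrite memv_cap -!memv_preim -xE -yE xX yX.
  case=> z; rewrite memv_cap -!memv_preim => /andP[zX zY] ->.
  by rewrite comp_lfunE -{2}g12 !memv_img.
have gf_inj : lker (g1 \o f1)%VF == 0%VS.
  apply/lker0P=> x y; rewrite !comp_lfunE.
  by move/(lker0P g1_inj)/(lker0P f1_inj).
have := dimv_sum_cap (vspan v XA) (vspan v XB).
rewrite -vspanU -defX defI inj_dim // vXA vXB !inj_dim //.
rewrite -ABconn // -v1A // -v2B //.
have := lconnK M XA XB; rewrite -defX; clear; lia.
Qed.

End Representation.

(** * Labels of sets on the right of a separation *)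

Section Labels.
Variables (F : finFieldType) (T : finType).

(** In a representation, the two equations say that the boundary of [(A, B)] lies
    in the span of [A0 :|: K] and that the span of [K] avoids it; so modulo the
    span of [K] the boundary is carried into the boundary of [(A0, B0)]. *)
Definition anchored (M : matroid T) (A0 B0 A B K : {set T}) :=
  [/\ A0 :|: K \subset A, K :|: B \subset B0,
      lconn M (A0 :|: K) B = lconn M A B & lconn M K B = 0].

(** The label of [Z] is the trace of its span on the boundary of [(A0, B0)], in
    the coordinates of a frame. As this refers to [A0] and [B0] only, the same
    label function serves all separations anchored at [(A0, B0)]: the trace of
    [Y] on the boundary of [(A, B)] can be computed from the trace of [Y :|: K]
    on the boundary of [(A0, B0)]. *)
Lemma representable_labels (N : matroid T) (t : nat) (A0 B0 : {set T}) :
    representable F N -> A0 \subset ground N -> B0 \subset ground N ->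
    lconn N A0 B0 <= t ->
  exists label : {set T} -> {vspace 'rV[F]_t}, forall A B K Y1 Y2 : {set T},
    A \subset ground N -> anchored N A0 B0 A B K ->
    Y1 \subset B -> Y2 \subset B -> label (Y1 :|: K) = label (Y2 :|: K) ->
    twins N A Y1 Y2.
Proof.
case=> m [v vN] sA0 sB0 conn_t; have {}vN : represents v N by exact: vN.
have [] := @frame_exists _ _ (vspan v A0 :&: vspan v B0)%VS t.
  by rewrite -(represents_lconn vN).
move=> f f_img; exists (fun Z => f @^-1: vspan v Z)%VS => A B K Y1 Y2 sA.
case=> sA0K sKB connAK connK sY1 sY2 eq_label X sX.
have sB : B \subset ground N by set_dec.
have sK : K \subset ground N by set_dec.
have sA0K' : A0 :|: K \subset ground N by set_dec.
(* Both equations of [anchored], in terms of spans. *)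
have A0KE : (vspan v A :&: vspan v B <= vspan v A0 + vspan v K)%VS.
  rewrite -vspanU; apply: subv_trans (capvSl _ (vspan v B)).
  rewrite -(dimv_leqif_sup (capvS (vspanS v sA0K) (subvv _))).
  by rewrite -!(represents_lconn vN) // connAK.
have KE : (vspan v K :&: vspan v B)%VS = 0%VS.
  by apply/eqP; rewrite -dimv_eq0 -(represents_lconn vN) // connK.
have traceE (Y : {set T}) : Y \subset B -> (vspan v X :&: vspan v Y =
    vspan v X :&: (vspan v A :&: vspan v B :&:
      (f @: (f @^-1: vspan v (Y :|: K)) + vspan v K)))%VS.
  move=> sY; have sYK : Y :|: K \subset B0 by set_dec.
  have -> : (f @: (f @^-1: vspan v (Y :|: K)) =
      vspan v A0 :&: vspan v (Y :|: K))%VS.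
    rewrite -lpreim_cap_limg lpreimK ?capvSr // f_img.
    rewrite capvC -capvA; congr (_ :&: _)%VS.
    by apply/capv_idPr/vspanS.
  apply/vspaceP=> w; rewrite !memv_cap.
  have [wX|//] := boolP (w \in vspan v X).
  rewrite (subvP (vspanS v sX) w wX) /=.
  apply/idP/andP=> [wY | [wB]].
    have wB := subvP (vspanS v sY) w wY.
    split=> //; have /memv_addP[a aA0 [k kK wE]] : w \in (vspan v A0 + vspan v K)%VS.
      by apply: (subvP A0KE); rewrite memv_cap wB (subvP (vspanS v sX)).
    rewrite wE memv_add // memv_cap aA0 vspanU.
    have -> : a = (w - k)%R by rewrite wE addrK.
    by rewrite memv_add ?memvN.
  move=> /memv_addP[a]; rewrite memv_cap => /andP[_].
  rewrite vspanU => /memv_addP[y yY [k' k'K ->]] [k kK wE].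
  have : (k' + k)%R \in (vspan v K :&: vspan v B)%VS.
    rewrite memv_cap memvD //=.
    have -> : (k' + k = w - y)%R by rewrite wE (addrAC _ k) (addrAC y) subrr add0r.
    by rewrite memvB // (subvP (vspanS v sY)).
  by rewrite KE memv0 wE -addrA => /eqP->; rewrite addr0.
have sub_B (Y : {set T}) : Y \subset B -> Y \subset ground N by move/subset_trans->.
have sXN : X \subset ground N by exact: subset_trans sX sA.
rewrite !(represents_lconn vN) //; first last.
- exact: sub_B.
- exact: sub_B.
by rewrite !traceE // eq_label.
Qed.

End Labels.

Section ElementLabels.
Variables (F : finFieldType) (T : finType) (M : matroid T).
Hypothesis minorsF : forall N : matroid T, proper_minor N M -> representable F N.

Lemma minor_representable (C D : {set T}) :
  C :|: D \subset ground M -> [disjoint C & D] -> C :|: D != set0 ->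
  representable F (delete (contract M C) D).
Proof. by move=> *; apply: minorsF; exists C, D; split. Qed.

(** [M] need not be representable, but the sets that avoid [e] can be labelled in
    [M \ e], and those that contain [e] in [M / e]. The label records which
    case holds; being anchored passes to both minors by [lconn_inherit]. *)
Lemma element_labels (t : nat) (A0 B0 : {set T}) e :
    e \in B0 -> A0 \subset ground M -> B0 \subset ground M ->
    lconn M A0 B0 <= t ->
  exists label : {set T} -> bool * {vspace 'rV[F]_t},
    forall A B K Y1 Y2 : {set T},
    A \subset ground M -> e \in B -> e \notin A -> anchored M A0 B0 A B K ->
    Y1 \subset B -> Y2 \subset B -> label (Y1 :|: K) = label (Y2 :|: K) ->
    twins M A Y1 Y2.
Proof.
move=> eB0 sA0 sB0 conn_t.
(* If [e] is in [A0], no set [A] satisfies the hypotheses. *)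
have [eA0|eA0] := boolP (e \in A0).
  exists (fun _ => (true, 0%VS)) => A B K Y1 Y2 sA eB eA [sA0K _ _ _].
  by case/negP: eA; apply: (subsetP sA0K); rewrite inE eA0.
have eM : [set e] \subset ground M by rewrite sub1set (subsetP sB0).
have e_n0 : [set e] != set0 by apply/set0Pn; exists e; rewrite set11.
set N1 := delete (contract M set0) [set e].
have N1F : representable F N1.
  by apply: minor_representable; rewrite ?set0U // -setI_eq0 set0I.
set N2 := delete (contract M [set e]) set0.
have N2F : representable F N2.
  by apply: minor_representable; rewrite ?setU0 // -setI_eq0 setI0.
have N1r (X : {set T}) : e \notin X -> rank N1 X = rank M X.
  move=> eX; rewrite /= /delete_rank /= /contract_rank rank0 subn0 setU0.
  congr (rank M _); apply/setP=> x; rewrite !inE.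
  by case: eqP => // ->; rewrite (negPf eX).
have N2r (X : {set T}) : rank N2 X + rank M [set e] = rank M (X :|: [set e]).
  by rewrite /= /delete_rank /= setD0 contract_rankK.
have N1c (X Y : {set T}) : e \notin X -> e \notin Y -> lconn N1 X Y = lconn M X Y.
  by move=> eX eY; rewrite /lconn !N1r ?inE ?negb_or ?eX.
(* Chain rule for the local connectivity. *)
have N2c (X Y : {set T}) : e \in Y ->
    lconn N2 X (Y :\ e) + lconn M X [set e] = lconn M X Y.
  move=> eY; have defY : Y :\ e :|: [set e] = Y by rewrite setUC setD1K.
  have := lconnK N2 X (Y :\ e); have := lconnK M X [set e].
  have := lconnK M X Y; have := N2r X; have := N2r (Y :\ e).
  have := N2r (X :|: Y :\ e); rewrite -setUA defY; clear; lia.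
have ground1 (X : {set T}) :
    X \subset ground M -> e \notin X -> X \subset ground N1.
  by move=> sX eX; rewrite /= subsetD1 eX setD0 sX.
have ground2 (X : {set T}) :
    X \subset ground M -> e \notin X -> X \subset ground N2.
  by move=> sX eX; rewrite /= setD0 subsetD1 eX sX.
have subD1 (X : {set T}) : X :\ e \subset X by apply: subsetDl.
have sB0e : B0 :\ e \subset ground M by apply: subset_trans (subD1 _) _.
have [] := @representable_labels _ _ _ t A0 (B0 :\ e) N1F.
- exact: ground1.
- by apply: ground1; rewrite ?setD11.
- rewrite N1c ?setD11 //; apply: leq_trans conn_t.
  exact: lconnS.
move=> lab1 lab1P.
have [] := @representable_labels _ _ _ t A0 (B0 :\ e) N2F.
- exact: ground2.
- by apply: ground2; rewrite ?setD11.
- apply: leq_trans conn_t; rewrite -(N2c A0 _ eB0).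
  exact: leq_addr.
move=> lab2 lab2P.
exists (fun Z : {set T} => (e \in Z, if e \in Z then lab2 (Z :\ e) else lab1 Z)).
move=> A B K Y1 Y2 sA eB eA [sA0K sKB connAK connK] sY1 sY2.
have eA0K : e \notin A0 :|: K by apply: contra eA => /(subsetP sA0K).
have eK : e \notin K by apply: contra eA0K; rewrite inE orbC => ->.
have sKBe : K :|: (B :\ e) \subset B0 :\ e.
  apply/subsetP=> x; rewrite !inE; case: eqP => [->|_] /=.
    by rewrite (negPf eK).
  by move=> xKB; apply: (subsetP sKB); rewrite inE.
have sA0K1 : A0 \subset A by set_dec.
have anch1 : anchored N1 A0 (B0 :\ e) A (B :\ e) K.
  split=> //; rewrite !N1c ?setD11 //.
    exact: (lconn_inherit sA0K).
  by apply/eqP; rewrite -leqn0 -connK lconnS.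
have anch2 : anchored N2 A0 (B0 :\ e) A (B :\ e) K.
  split=> //; apply/eqP.
    rewrite -(eqn_add2r (lconn M A [set e])) N2c //.
    rewrite -connAK -(lconn_inherit sA0K _ connAK) ?sub1set //.
    by rewrite N2c.
  by have := N2c K B eB; rewrite connK; clear; lia.
rewrite !inE (negPf eK) !orbF => -[eY12].
rewrite -eY12; case: ifP => [eY1|/negbT eY1] eq_lab X sX.
  have eY2 : e \in Y2 by rewrite -eY12.
  rewrite -(N2c X Y1 eY1) -(N2c X Y2 eY2).
  congr (_ + _); apply: (lab2P _ _ _ _ _ _ anch2) => //; rewrite ?setSD //.
    exact: ground2.
  have KE : K :\ e = K by apply/setDidPl; rewrite disjoint_sym disjoints1.
  by move: eq_lab; rewrite !setDUl KE.
have eY2 : e \notin Y2 by rewrite -eY12.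
have eX : e \notin X by apply: contra eA; apply: (subsetP sX).
rewrite -!N1c //; apply: (lab1P _ _ _ _ _ _ anch1) => //.
- exact: ground1.
- by rewrite subsetD1 sY1.
- by rewrite subsetD1 sY2.
Qed.

End ElementLabels.

(** * Tutte's linking theorem *)

Section Linking.
Variable (T : finType).

(** An element [e] outside [A] and [B] can be deleted or contracted without
    destroying the hypothesis. Otherwise there are a set [Z1] that is too weakly
    connected in [M \ e] and a set [Z2] that is so in [M / e]; by submodularity
    [Z1 :&: Z2] or [Z1 :|: Z2 :|: [set e]] is then too weakly connected in
    [M]. The set [L] collects the contracted elements. *)
Lemma tutte_linking (M : matroid T) (A B : {set T}) t :
    A \subset ground M -> B \subset ground M -> [disjoint A & B] ->
    (forall Z : {set T}, A \subset Z -> Z \subset ground M :\: B ->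
       rank M (ground M) + t <= rank M Z + rank M (ground M :\: Z)) ->
  exists L : {set T}, L \subset ground M :\: (A :|: B) /\
    rank M (A :|: L :|: B) + rank M L + t <=
      rank M (A :|: L) + rank M (B :|: L).
Proof.
have [n] := ubnP #|ground M :\: (A :|: B)|.
elim: n M => // n IHn M ltMn sA sB disAB kappa.
have [E0|[e]] := set_0Vmem (ground M :\: (A :|: B)).
  exists set0; rewrite sub0set !setU0 rank0 addn0.
  have defM : ground M = A :|: B.
    by apply/eqP; rewrite eqEsubset subUset sA sB -setD_eq0 E0 eqxx.
  have defB : B = ground M :\: A.
    by rewrite defM setDUl setDv set0U; apply/esym/setDidPl; rewrite disjoint_sym.
  split=> //; rewrite -defM [in leqRHS]defB; apply: kappa => //.
  by rewrite subsetD sA.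
rewrite !inE negb_or => /andP[/andP[eA eB] eM].
set E := ground M in sA sB kappa ltMn eM *.
have smaller (N : matroid T) : ground N = E :\ e ->
    #|ground N :\: (A :|: B)| < n.
  move=> ->; rewrite -ltnS; apply: leq_trans ltMn; rewrite ltnS.
  apply: proper_card; rewrite properE setSD ?subsetDl //=.
  by apply/subsetPn; exists e; rewrite !inE ?eqxx ?negb_or ?eA ?eB ?eM ?andbF.
have sA' : A \subset E :\ e by rewrite subsetD1 sA.
have sB' : B \subset E :\ e by rewrite subsetD1 sB.
have re (X : {set T}) : e \notin X -> X :\ e = X.
  by move=> eX; apply/setDidPl; rewrite disjoint_sym disjoints1.
have [/exists_inP[Z1]|noZ1] := boolP [exists (Z : {set T} |
    (A \subset Z) && (Z \subset E :\ e :\: B)),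
    rank M Z + rank M (E :\ e :\: Z) < rank M (E :\ e) + t]; last first.
  have [] := IHn (delete M [set e]) (smaller (delete M [set e]) erefl) => //.
    move=> Z sAZ sZB; rewrite /= /delete_rank -/E.
    have eZ : e \notin Z.
      by apply/negP=> /(subsetP sZB); rewrite !inE eqxx andbF.
    rewrite (re Z eZ) (re (E :\ e)) ?setD11 // (re (E :\ e :\: Z)).
      rewrite leqNgt; apply: contra noZ1 => ltZ.
      by apply/exists_inP; exists Z; rewrite ?sAZ.
    by rewrite !inE eqxx andbF.
  move=> L [sL]; rewrite /= /delete_rank.
  have eL : e \notin L by apply/negP=> /(subsetP sL); rewrite !inE eqxx andbF.
  rewrite !re ?inE ?(negPf eA) ?(negPf eB) ?(negPf eL) //= => leL.
  exists L; split=> //; apply: subset_trans sL _.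
  by rewrite setSD // subsetDl.
case/andP=> sAZ1 sZ1B ltZ1.
have [/exists_inP[Z2]|noZ2] := boolP [exists (Z : {set T} |
    (A \subset Z) && (Z \subset E :\ e :\: B)),
    rank M (Z :|: [set e]) + rank M (E :\: Z) < rank M E + rank M [set e] + t].
  case/andP=> sAZ2 sZ2B ltZ2.
  have eZ1 : e \notin Z1.
    by apply/negP=> /(subsetP sZ1B); rewrite !inE eqxx andbF.
  have eZ2 : e \notin Z2.
    by apply/negP=> /(subsetP sZ2B); rewrite !inE eqxx andbF.
  have sub1 := @rank_submodS _ M Z1 (Z2 :|: [set e]) (Z1 :&: Z2)
    (Z1 :|: Z2 :|: [set e]).
  have := sub1 _ (setUA _ _ _); rewrite setIS ?subsetUl // => /(_ isT) {}sub1.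
  have := @rank_submodS _ M (E :\ e :\: Z1) (E :\: Z2)
    (E :\: (Z1 :|: Z2 :|: [set e])) (E :\: (Z1 :&: Z2)).
  have -> : E :\: (Z1 :|: Z2 :|: [set e]) \subset
    (E :\ e :\: Z1) :&: (E :\: Z2) by set_dec.
  have -> : (E :\ e :\: Z1) :|: (E :\: Z2) = E :\: (Z1 :&: Z2).
    apply/setP=> x; rewrite !inE; case: eqP => [->|_] /=.
      by rewrite (negPf eZ1) (negPf eZ2).
    by case: (x \in Z1); case: (x \in Z2); case: (x \in E).
  move=> /(_ isT erefl) sub2.
  have kI : rank M E + t <= rank M (Z1 :&: Z2) + rank M (E :\: (Z1 :&: Z2)).
    by apply: kappa; set_dec.
  have sE1 : [set e] \subset E by rewrite sub1set.
  have kU : rank M E + t <= rank M (Z1 :|: Z2 :|: [set e]) +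
      rank M (E :\: (Z1 :|: Z2 :|: [set e])).
    apply: kappa; first by set_dec.
    have sBe : [set e] \subset ~: B by rewrite sub1set inE.
    by set_dec.
  have re1 : rank M [set e] <= 1.
    apply: leq_trans (rank_le_card _ _) _.
    by rewrite -(cards1 e) subset_leq_card // subsetIl.
  have rE : rank M (E :\ e) <= rank M E by rewrite rank_mono ?subsetDl.
  move: ltZ1 ltZ2 sub1 sub2 kI kU re1 rE; clear; lia.
have Nr (X : {set T}) :
    rank (contract M [set e]) X + rank M [set e] = rank M (X :|: [set e]).
  exact: contract_rankK.
have [] := IHn (contract M [set e]) (smaller (contract M [set e]) erefl) => //.
  move=> Z sAZ sZB; have := Nr Z; have := Nr (ground (contract M [set e])).
  have := Nr (ground (contract M [set e]) :\: Z); rewrite /= -/E.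
  have eZ : e \notin Z by apply/negP=> /(subsetP sZB); rewrite !inE eqxx andbF.
  have -> : (E :\ e :\: Z) :|: [set e] = E :\: Z.
    by apply/setP=> x; rewrite !inE; case: eqP => [->|_]; rewrite ?eZ ?eM ?orbF.
  have -> : (E :\ e) :|: [set e] = E by rewrite setUC setD1K.
  have : rank M E + rank M [set e] + t <= rank M (Z :|: [set e]) + rank M (E :\: Z).
    rewrite leqNgt; apply: contra noZ2 => ltZ.
    by apply/exists_inP; exists Z; rewrite ?sAZ.
  clear; lia.
move=> L [sL leL]; exists (L :|: [set e]); split.
  rewrite subUset sub1set !inE negb_or eA eB eM.
  apply/andP; split=> //; apply: subset_trans sL _.
  by rewrite setSD // subsetDl.
have := Nr (A :|: L :|: B); have := Nr L; have := Nr (A :|: L).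
have := Nr (B :|: L); move: leL.
rewrite !(setUA _ L [set e]) (setUAC _ [set e] B); clear; lia.
Qed.

End Linking.

(** * Linked chains *)

Section OneCut.
Variables (T : finType) (M : matroid T).
Local Notation r := (rank M).

(** A link across a separation of the same connectivity: [K] and [K'] are the
    parts of the link on the two sides. Since no connectivity is lost when the
    link is contracted, neither part has anything in common with the opposite
    side, and [A0 :|: K] spans the whole boundary. *)
Lemma linked_cut (A0 A B0 B K K' : {set T}) (t : nat) :
    A0 :|: K \subset A -> B0 :|: K' \subset B ->
    lconn M A0 (B0 :|: (K :|: K')) <= t ->
    lconn M (A0 :|: (K :|: K')) B0 <= t -> lconn M A B = t ->
    r (A0 :|: (K :|: K') :|: B0) + r (K :|: K') + t
      <= r (A0 :|: (K :|: K')) + r (B0 :|: (K :|: K')) ->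
  [/\ lconn M (A0 :|: K) (B0 :|: K') = t, lconn M (A0 :|: K) B = t,
      lconn M K B = 0 & lconn M A K' = 0].
Proof.
move=> sA sB conn0 connm connAB link.
have sA' : A0 \subset A by set_dec.
have sB' : B0 \subset B by set_dec.
have c0 := lconnK M A0 (K :|: K').
have c0' := lconnK M A0 (B0 :|: (K :|: K')); rewrite setUA setUAC in c0'.
have cm := lconnK M B0 (K :|: K').
have cm' := lconnK M (A0 :|: (K :|: K')) B0.
have cK := lconnK M K K'.
have cA0 := lconnK M A0 K; have cB0 := lconnK M B0 K'.
have mA0 : lconn M A0 K <= lconn M A0 (K :|: K').
  by rewrite lconnS ?subsetUl.
have mB0 : lconn M B0 K' <= lconn M B0 (K :|: K').
  by rewrite lconnS ?subsetUr.
have ct := lconnK M (A0 :|: K) (B0 :|: K').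
have cB := lconnK M (A0 :|: K) B; have cA := lconnK M A (B0 :|: K').
have mB : lconn M (A0 :|: K) B <= t by rewrite -connAB lconnS.
have mA : lconn M A (B0 :|: K') <= t by rewrite -connAB lconnS.
have mtB : lconn M (A0 :|: K) (B0 :|: K') <= lconn M (A0 :|: K) B by rewrite lconnS.
have mtA : lconn M (A0 :|: K) (B0 :|: K') <= lconn M A (B0 :|: K') by rewrite lconnS.
have cKB := lconnK M K B; have cAK := lconnK M A K'.
have defU : A0 :|: K :|: (B0 :|: K') = A0 :|: (K :|: K') :|: B0 by set_dec.
have sub1 : r (A0 :|: K :|: B) + r (B0 :|: (K :|: K')) <=
    r (A0 :|: (K :|: K') :|: B0) + r (K :|: B).
  rewrite -defU; apply: rank_submodS; first by set_dec.
  by set_dec.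
have sub2 : r (A :|: (B0 :|: K')) + r (A0 :|: (K :|: K')) <=
    r (A0 :|: (K :|: K') :|: B0) + r (A :|: K').
  rewrite -defU; apply: rank_submodS; first by set_dec.
  by set_dec.
rewrite defU in ct.
move: c0 c0' cm cm' cK cA0 cB0 mA0 mB0 ct cB cA mB mA mtB mtA cKB cAK sub1 sub2.
move: conn0 connm link; clear => *.
split; lia.
Qed.

End OneCut.

Section LinkedChain.
Variables (T : finType) (M : matroid T).
Implicit Types (A : nat -> {set T}).
Local Notation r := (rank M).
Local Notation G := (ground M).

(** The last field says that contracting [L] leaves connectivity at least [t]
    between [A 0] and the complement of [A m]. *)
Record linked_chain A m (L : {set T}) t : Prop := LinkedChain {
  chain_ground : forall i, i <= m -> A i \subset G;
  chain_proper : forall i, i < m -> A i \proper A i.+1;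
  chain_conn : forall i, i <= m -> lconn M (A i) (G :\: A i) = t;
  link_sub : L \subset A m :\: A 0;
  link_conn : r (A 0 :|: L :|: (G :\: A m)) + r L + t
                <= r (A 0 :|: L) + r ((G :\: A m) :|: L) }.

Variables (A : nat -> {set T}) (m : nat) (L : {set T}) (t : nat).
Hypothesis chainA : linked_chain A m L t.

Lemma chain_subset i j : i <= j -> j <= m -> A i \subset A j.
Proof.
elim: j => [|j IHj]; first by rewrite leqn0 => /eqP->.
rewrite leq_eqVlt ltnS => /orP[/eqP-> // | leij] ltjm.
apply: subset_trans (IHj leij (ltnW ltjm)) _.
exact: proper_sub (chain_proper chainA ltjm).
Qed.

End LinkedChain.

(** * States of the cuts, and amalgamation of two of them *)

Section CutStates.
Variables (F : finFieldType) (T : finType) (M : matroid T).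
Variables (A : nat -> {set T}) (m : nat) (L : {set T}) (t : nat).
Hypothesis chainA : linked_chain M A m L t.
Local Notation r := (rank M).
Local Notation B i := (ground M :\: A i).

Lemma chain_cut i : i <= m ->
  [/\ lconn M (A 0 :|: L :&: A i) (B m :|: L :\: A i) = t,
      lconn M (A 0 :|: L :&: A i) (B i) = t,
      lconn M (L :&: A i) (B i) = 0 & lconn M (A i) (L :\: A i) = 0].
Proof.
move=> leim.
have sL := link_sub chainA.
have sA0 := chain_subset chainA (leq0n i) leim.
have sAi := chain_subset chainA leim (leqnn m).
have sAm := chain_ground chainA (leqnn m).
apply: linked_cut; rewrite ?setID.
- by set_dec.
- by set_dec.
- rewrite -(chain_conn chainA (leq0n m)); apply: lconnS => //.
  by set_dec.
- rewrite -(chain_conn chainA (leqnn m)); apply: lconnS => //.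
  by set_dec.
- exact: (chain_conn chainA).
- exact: (link_conn chainA).
Qed.

Definition link_step j := L :&: (A j.+1 :\: A j).

(** The elements between [A j] and [A j.+1] are removed, those of the link by
    contraction and the others by deletion. *)
Definition cut_minor j : matroid T :=
  delete (contract M (link_step j)) (A j.+1 :\: A j :\: link_step j).

Lemma cut_minor_rank j (X : {set T}) : X \subset A j :|: B j.+1 ->
  rank (cut_minor j) X + r (link_step j) = r (X :|: link_step j).
Proof.
move=> sX; rewrite /= /delete_rank /= (_ : X :\: _ = X) ?contract_rankK //.
apply/setDidPl; rewrite -setI_eq0 -subset0.
rewrite /link_step.
by set_dec.
Qed.

Lemma cut_minor_ground j : j < m -> A j :|: B j.+1 \subset ground (cut_minor j).
Proof.
move=> ltjm; have sG := chain_ground chainA ltjm.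
have sA := proper_sub (chain_proper chainA ltjm).
by rewrite /= /link_step; set_dec.
Qed.

(** The link makes the two sides that remain in the minor as connected as the
    separations of the chain are, so that the boundary has a frame of the full
    dimension [t]. *)
Lemma cut_minor_conn j : j < m -> lconn (cut_minor j) (A j) (B j.+1) = t.
Proof.
move=> ltjm; have lejm := ltnW ltjm.
have sL := link_sub chainA.
have sA0 := chain_subset chainA (leq0n j) lejm.
have sAj := proper_sub (chain_proper chainA ltjm).
have sAm := chain_subset chainA ltjm (leqnn m).
have sG := chain_ground chainA (leqnn m).
have [tE _ _ skewA] := chain_cut lejm.
have [_ _ skewB _] := chain_cut ltjm.
set C := link_step j.
have sCA : C \subset L :\: A j by rewrite /C /link_step; set_dec.
have sCB : C \subset L :&: A j.+1 by rewrite /C /link_step; set_dec.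
have rA := skew_rank skewA (subxx _) sCA.
have rB := skew_rank skewB sCB (subxx _); rewrite setUC in rB.
have up : lconn M (A j) (B j.+1 :|: C) <= t.
  rewrite -(chain_conn chainA lejm); apply: lconnS => //.
  by rewrite /C /link_step; set_dec.
have lo : t <= lconn M (A j) (B j.+1 :|: C).
  rewrite -[X in X <= _]tE; apply: lconnS; first by set_dec.
  by rewrite /C /link_step; set_dec.
have := lconnK M (A j) (B j.+1 :|: C).
have := lconnK (cut_minor j) (A j) (B j.+1).
have := cut_minor_rank (subsetUl (A j) (B j.+1)).
have := cut_minor_rank (subsetUr (A j) (B j.+1)).
have := cut_minor_rank (subxx (A j :|: B j.+1)).
rewrite -/C -setUA; move: rA rB up lo; clear; lia.
Qed.

Variable label : {set T} -> bool * {vspace 'rV[F]_t}.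

(** The union with [L :&: A i] carries a set on the right of [A i] back to the
    right of [A 0], where the labels are read; thus labels of sets at different
    positions of the chain are comparable. *)
Hypothesis labelP : forall i (Y1 Y2 : {set T}), i <= m ->
  Y1 \subset B i -> Y2 \subset B i ->
  label (Y1 :|: L :&: A i) = label (Y2 :|: L :&: A i) -> twins M (A i) Y1 Y2.

(** The state forgets the elements of the matroid: it only says which traces occur
    together with which labels, so that there are boundedly many states. *)
Definition cut_state j (s : {set (bool * {vspace 'rV[F]_t}) * {vspace 'rV[F]_t}}) :=
  exists n (v : T -> 'cV[F]_n) (f : 'Hom('rV[F]_t, 'cV[F]_n)),
  [/\ represents v (cut_minor j), lker f == 0%VS,
      limg f = (vspan v (A j) :&: vspan v (B j.+1))%VS &
      s = [set (label (Y :|: L :&: A j.+1), (f @^-1: vspan v Y)%VS)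
            | Y : {set T} in powerset (B j.+1)]].

Lemma cut_state_exists j : j < m -> representable F (cut_minor j) ->
  exists s, cut_state j s.
Proof.
move=> ltjm [n [v vN]]; have {}vN : represents v (cut_minor j) by exact: vN.
have sG := cut_minor_ground ltjm.
have dimW : \dim (vspan v (A j) :&: vspan v (B j.+1))%VS = t.
  rewrite -(represents_lconn vN) ?cut_minor_conn //.
    exact: subset_trans (subsetUl _ _) sG.
  exact: subset_trans (subsetUr _ _) sG.
have [] := @frame_exists _ _ (vspan v (A j) :&: vspan v (B j.+1))%VS t.
  by rewrite dimW.
move=> f f_img; eexists; exists n, v, f; split=> //.
by apply: frame_inj; rewrite f_img.
Qed.

(** Let [a] be [i.+1]. The representation [v2] at [j], modulo the span of the
    part [K] of the link between [A a] and [A j], represents [M] on [A a], with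
    the frame [f2] carried along; the representation [v1] at [i] represents
    [M] on the complement [B a]. For [Y] in [B a], equality of the states gives
    [Y'] in [B j.+1] with the same trace and with the same label. By the label,
    [Y] is a twin of [Y' :|: (K :|: C)], where [K :|: C] is the part of the link
    between [A a] and [A j.+1]; and the local connectivity of [X] in [A a] with
    the latter is that of [X :|: K] with [Y'] in the minor at [j], which the
    representation [v2] computes from traces. *)
Lemma equal_states_glue i j s : i < j -> j < m ->
  cut_state i s -> cut_state j s -> representable F M.
Proof.
move=> ltij ltjm [n1 [v1 [f1 [v1N f1_inj f1_img s1E]]]].
move=> [n2 [v2 [f2 [v2N f2_inj f2_img s2E]]]].
have lejm := ltnW ltjm; have ltim := ltn_trans ltij ltjm.
set a := i.+1 in s1E *.
have leam : a <= m by [].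
have sL := link_sub chainA.
have sAi := proper_sub (chain_proper chainA ltim).
have sAa := chain_subset chainA ltij lejm.
have sAj := proper_sub (chain_proper chainA ltjm).
have sGj := chain_ground chainA ltjm.
have [_ _ skewBa skewAa] := chain_cut leam.
have [_ _ _ skewAj] := chain_cut lejm.
have [_ _ skewBj _] := chain_cut ltjm.
set Ci := link_step i; set C := link_step j.
pose K := L :&: (A j :\: A a).
have sCi : Ci \subset L :&: A a by rewrite /Ci /link_step; set_dec.
have sCj : C \subset L :\: A j by rewrite /C /link_step; set_dec.
have sKa : K :|: C \subset L :\: A a by rewrite /K /C /link_step; set_dec.
have sKj : K :|: C \subset L :&: A j.+1 by rewrite /K /C /link_step; set_dec.
have sC : C \subset L :&: A j.+1 by rewrite /C /link_step; set_dec.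
have sKA : K \subset A j by rewrite /K; set_dec.
have gi := cut_minor_ground ltim; have gj := cut_minor_ground ltjm.
(* The link is skew to each side of each separation of the chain, so that the
   contractions do not change the ranks of the sets involved. *)
have rankB (Y : {set T}) : Y \subset B a -> r Y = rank (cut_minor i) Y.
  move=> sY; have := cut_minor_rank (subset_trans sY (subsetUr (A i) (B a))).
  have := skew_rank skewBa sCi sY; rewrite setUC -/Ci; clear; lia.
have rankK : rank (cut_minor j) K + r C = r (K :|: C).
  by apply: cut_minor_rank; apply: subset_trans sKA (subsetUl _ _).
have rankA (X : {set T}) : X \subset A a ->
    rank (cut_minor j) X = r X /\
    rank (cut_minor j) (X :|: K) = r X + rank (cut_minor j) K.
  move=> sX; have sXj := subset_trans sX sAa.
  have := @cut_minor_rank j X (subset_trans sXj (subsetUl _ _)).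
  have sXK : X :|: K \subset A j by rewrite subUset sXj.
  have := cut_minor_rank (subset_trans sXK (subsetUl (A j) (B j.+1))).
  have := skew_rank skewAj sXj sCj; have := skew_rank skewAa sX sKa.
  rewrite -/C setUA; move: rankK; clear; lia.
have rankY (Y : {set T}) : Y \subset B j.+1 ->
    rank (cut_minor j) Y = r Y /\
    rank (cut_minor j) (K :|: Y) = r Y + rank (cut_minor j) K /\
    r (Y :|: (K :|: C)) = r Y + r (K :|: C).
  move=> sY; have := cut_minor_rank (subset_trans sY (subsetUr (A j) (B j.+1))).
  have sKY : K :|: Y \subset A j :|: B j.+1 by apply: setUSS.
  have := cut_minor_rank sKY; rewrite -/C.
  have := skew_rank skewBj sC sY; have := skew_rank skewBj sKj sY.
  rewrite (setUC _ Y) (setUC _ Y) (setUC K Y) -setUA.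
  move: rankK; clear; lia.
have subA (X : {set T}) : X \subset A j -> X \subset ground (cut_minor j).
  by move=> sX; apply: subset_trans (subset_trans sX (subsetUl _ _)) gj.
have subB (Y : {set T}) : Y \subset B j.+1 -> Y \subset ground (cut_minor j).
  by move=> sY; apply: subset_trans (subset_trans sY (subsetUr _ _)) gj.
(* The contraction of [K] in the representation at [j]. *)
have [p pker] := projection_along (vspan v2 K).
have capAK (X : {set T}) : X \subset A a -> (vspan v2 X :&: vspan v2 K = 0)%VS.
  move=> sX; apply/eqP; rewrite -dimv_eq0 -(represents_lconn v2N).
  - have [] := rankA X sX; have := lconnK (cut_minor j) X K; clear; lia.
  - by apply: subA; apply: subset_trans sX sAa.
  - exact: subA.
have pv2 (X : {set T}) : (p @: vspan v2 X)%VS = vspan (p \o v2) X.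
  exact: limg_vspan.
apply: (@glue F T _ _ _ (p \o v2) v1 (p \o f2)%VF f1 M (A a) (B a)) => //.
- apply/lker0P=> x y; rewrite !comp_lfunE => /eqP.
  rewrite -subr_eq0 -linearB -memv_ker pker -linearB => fK.
  have : f2 (x - y)%R \in (vspan v2 K :&: vspan v2 (B j.+1))%VS.
    rewrite memv_cap fK; have := memv_img f2 (memvf (x - y)%R).
    by rewrite f2_img memv_cap => /andP[].
  have -> : (vspan v2 K :&: vspan v2 (B j.+1) = 0)%VS.
    apply/eqP; rewrite -dimv_eq0 -(represents_lconn v2N).
    + have [] := rankY (B j.+1) (subxx _).
      have := lconnK (cut_minor j) K (B j.+1); clear; lia.
    + exact: subA.
    + exact: subB.
  rewrite memv0 => /eqP f20; apply/eqP; rewrite -subr_eq0; apply/eqP.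
  by apply: (lker0P f2_inj); rewrite f20 linear0.
- by set_dec.
- by rewrite -setI_eq0; apply/eqP; set_dec.
- move=> X sX; rewrite -pv2 limg_dim_eq ?pker ?capAK //.
  rewrite -v2N; first by have [] := rankA X sX.
  by apply: subA; apply: subset_trans sX sAa.
- move=> Y sY; rewrite rankB // v1N //.
  by apply: subset_trans (subset_trans sY (subsetUr _ _)) gi.
move=> X Y sX sY.
have preX : ((p \o f2) @^-1: vspan (p \o v2) X = f2 @^-1: vspan v2 (X :|: K))%VS.
  apply/vspaceP=> w; rewrite -!memv_preim comp_lfunE -pv2 vspanU.
  apply/memv_imgP/memv_addP=> [[x xX /eqP]|[x xX [k kK ->]]].
    rewrite -subr_eq0 -linearB -memv_ker pker => xK.
    by exists x => //; exists (f2 w - x)%R => //; rewrite addrC subrK.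
  exists x => //; rewrite linearD /=; move: kK; rewrite -pker memv_ker => /eqP->.
  by rewrite addr0.
have : (label (Y :|: L :&: A a), (f1 @^-1: vspan v1 Y)%VS) \in s.
  by rewrite s1E; apply/imsetP; exists Y; rewrite ?powersetE.
rewrite s2E => /imsetP[Y']; rewrite powersetE => sY' eq_pair.
have eq_label : label (Y :|: L :&: A a) = label (Y' :|: L :&: A j.+1).
  exact: (congr1 fst eq_pair).
have -> : (f1 @^-1: vspan v1 Y = f2 @^-1: vspan v2 Y')%VS.
  exact: (congr1 snd eq_pair).
have sXK : X :|: K \subset A j by rewrite subUset (subset_trans sX).
rewrite preX preim_frame_dim //; last first.
  by rewrite f2_img; apply: capvS; apply: vspanS.
rewrite -(represents_lconn v2N (subA _ sXK) (subB _ sY')).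
rewrite (@labelP a Y (Y' :|: (K :|: C)) leam sY) //.
- have [rY'1 [rY'2 rY'3]] := rankY Y' sY'; have [rX1 rX2] := rankA X sX.
  have := lconnK M X (Y' :|: (K :|: C)).
  have := lconnK (cut_minor j) (X :|: K) Y'.
  have sXKY : X :|: K :|: Y' \subset A j :|: B j.+1.
    by apply: setUSS.
  have := cut_minor_rank sXKY; rewrite -/C.
  have -> : X :|: K :|: Y' :|: C = X :|: (Y' :|: (K :|: C)).
    by rewrite -!setUA (setUCA K).
  move: rY'1 rY'3 rX2 rankK; clear; lia.
- by rewrite /K /C /link_step; clear -sY' sAa sAj sGj; set_dec.
- rewrite eq_label; congr label.
  by rewrite /K /C /link_step; clear -sAa sAj; set_dec.
Qed.

End CutStates.

(** * Extraction of a tight chain *)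

(** [c] is a lower bound for [lam] on all sets between the first and the last
    member, and [c + d] a strict upper bound on the members. Cut the chain into
    [m.+1] pieces. If on some piece the lower bound improves to [c.+1], continue
    with that piece; otherwise each piece contains a set at which [lam] takes
    the value [c], and these sets form the required chain. *)
Lemma tight_subchain (T : finType) (lam : {set T} -> nat) (m d c : nat)
    (A : nat -> {set T}) :
    let N := m.+1 ^ d in
    (forall i, i.+1 < N -> A i \proper A i.+1) ->
    (forall i, i < N -> lam (A i) < c + d) ->
    (forall Z : {set T}, A 0 \subset Z -> Z \subset A N.-1 -> c <= lam Z) ->
  exists t (X : nat -> {set T}),
    [/\ t < c + d, forall i, i <= m -> lam (X i) = t,
        forall i, i < m -> X i \proper X i.+1, X m \subset A N.-1 &
        forall Z : {set T}, X 0 \subset Z -> Z \subset X m -> t <= lam Z].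
Proof.
elim: d c A => [|d IHd] c A N properA lamA minA.
  by have := minA _ (subxx _) (subxx _); rewrite leqNgt -[X in _ < X]addn0 lamA.
have subA i j : i <= j -> j < N -> A i \subset A j.
  elim: j => [|j IHj]; first by rewrite leqn0 => /eqP->.
  rewrite leq_eqVlt ltnS => /orP[/eqP-> //|leij] ltj.
  exact: subset_trans (IHj leij (ltnW ltj)) (proper_sub (properA j ltj)).
have n_gt0 : 0 < m.+1 ^ d by rewrite expn_gt0.
set n := m.+1 ^ d in n_gt0 IHd.
have NE : N = m.+1 * n by rewrite /N expnS.
have piece p : p <= m -> p * n + n.-1 < N.
  by move=> lepm; rewrite NE -[X in _ < X]addn0; clear -lepm n_gt0; nia.
have [/existsP[p /forallP pP]|noP] := boolP [exists p : 'I_m.+1,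
    [forall Z : {set T}, (A (p * n) \subset Z) && (Z \subset A (p * n + n.-1))
       ==> (c < lam Z)]].
  have lep : p <= m by rewrite -ltnS ltn_ord.
  have [] := IHd c.+1 (fun i => A (p * n + i)).
  - move=> i lti; rewrite addnS; apply: properA.
    by move: (piece p lep) lti; clear; lia.
  - move=> i lti; rewrite addSnnS; apply: lamA.
    by move: (piece p lep) lti; clear; lia.
  - move=> Z; rewrite addn0 => sZ Zs; have := pP Z.
    by rewrite sZ Zs.
  move=> t [X [ltt lamX propX subX minX]]; exists t, X; split=> //.
    by rewrite addnS -addSn.
  apply: subset_trans subX _; apply: subA.
    by move: (piece p lep); clear; lia.
  by rewrite prednK // expn_gt0.
have /fin_all_exists[X XP] : forall p : 'I_m.+1, exists Z : {set T},
    [/\ A (p * n) \subset Z, Z \subset A (p * n + n.-1) & lam Z <= c].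
  move=> p; move: noP; rewrite negb_exists => /forallP/(_ p).
  rewrite negb_forall => /existsP[Z]; rewrite negb_imply -leqNgt.
  by case/andP=> /andP[sZ Zs] leZ; exists Z.
have lastN : N.-1 < N by rewrite prednK // expn_gt0.
have XA (p : 'I_m.+1) : A 0 \subset X p /\ X p \subset A N.-1.
  have [sX Xs _] := XP p; have lep : p <= m by rewrite -ltnS ltn_ord.
  have := piece p lep => ltp.
  split.
    apply: subset_trans sX; apply: subA => //.
    by move: ltp; clear; lia.
  by apply: subset_trans Xs _; apply: subA; move: ltp; clear; lia.
exists c, (fun i => X (inord i)); split=> //.
- by rewrite -[X in X < _]addn0 ltn_add2l.
- move=> i _; have [sX Xs leX] := XP (inord i).
  by apply/eqP; rewrite eqn_leq leX /=; have [] := XA (inord i); exact: minA.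
- move=> i ltim; have [_ Xs _] := XP (inord i); have [sX _ _] := XP (inord i.+1).
  apply: sub_proper_trans Xs _; apply: proper_sub_trans sX.
  rewrite !inordK //; last exact: ltnW.
  have -> : i.+1 * n = (i * n + n.-1).+1 by clear -n_gt0; lia.
  apply: properA; have := piece _ ltim.
  by clear -n_gt0; lia.
- by have [] := XA (inord m).
- move=> Z sZ Zs; apply: minA.
    by apply: subset_trans sZ; have [] := XA (inord 0).
  by apply: subset_trans Zs _; have [] := XA (inord m).
Qed.

(** * The bound *)

Section Excluded.
Variables (F : finFieldType) (T : finType) (M : matroid T).
Hypothesis exclM : excluded_minor (@representable F T) M.
Local Notation G := (ground M).

(** Two sides without local connectivity are glued along the zero space. *)
Lemma excluded_minor_connected (A B : {set T}) :
  A :|: B = G -> [disjoint A & B] -> A != set0 -> B != set0 ->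
  0 < lconn M A B.
Proof.
have [nF minorsF] := exclM.
move=> AB disAB A0 B0; rewrite lt0n; apply/negP=> /eqP conn0; apply: nF.
have restr (X Y : {set T}) : X :|: Y = G -> [disjoint X & Y] -> Y != set0 ->
    exists n (v : T -> 'cV[F]_n),
      forall Z : {set T}, Z \subset X -> rank M Z = \dim (vspan v Z).
  move=> XY disXY Yn0.
  have [||| n [v vN]] := @minor_representable F T M minorsF set0 Y.
  - by rewrite set0U -XY subsetUr.
  - by rewrite -setI_eq0 set0I.
  - by rewrite set0U.
  exists n, v => Z sZ; have defZ : Z :\: Y = Z.
    by apply/setDidPl; apply: disjointWl disXY.
  have <- : rank (delete (contract M set0) Y) Z = rank M Z.
    by rewrite /= /delete_rank /= /contract_rank defZ setU0 rank0 subn0.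
  apply: vN; rewrite /= setD0 -XY setDUl setDv setU0.
  by rewrite (setDidPl disXY).
have [n1 [v1 v1A]] := restr A B AB disAB B0.
have [n2 [v2 v2B]] : exists n (v : T -> 'cV[F]_n),
    forall Z : {set T}, Z \subset B -> rank M Z = \dim (vspan v Z).
  by apply: (restr B A) => //; rewrite 1?setUC 1?disjoint_sym.
have ker0 (vT : vectType F) (f : 'Hom('rV[F]_0, vT)) : lker f == 0%VS.
  by apply/lker0P=> x y _; rewrite [x]thinmx0 [y]thinmx0.
apply: (@glue F T 'rV[F]_0 _ _ v1 v2 0%R 0%R M A B) => // X Y sX sY.
have -> : lconn M X Y = 0 by apply/eqP; rewrite -leqn0 -conn0 lconnS.
apply/esym/eqP; rewrite -leqn0; apply: leq_trans (dimvS (subvf _)) _.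
by rewrite dimvf /dim /= muln0.
Qed.

(** The bound is the number of sets of pairs of a label and a subspace of [F^t],
    as there are at most [#|F| ^ (t * t)] subspaces. *)
Lemma linked_chain_bound (A : nat -> {set T}) m L t :
  linked_chain M A m L t -> G :\: A m != set0 ->
  m <= 2 ^ (2 * #|F| ^ (t * t) * #|F| ^ (t * t)).
Proof.
have [nF minorsF] := exclM.
move=> chainA /set0Pn[e eBm].
have sA := chain_ground chainA.
have eB i : i <= m -> e \in G :\: A i.
  move=> leim; apply: subsetP eBm; apply: setDS.
  exact: (chain_subset chainA).
have [||||label labelP] := @element_labels F T M minorsF t (A 0) (G :\: A 0) e.
- exact: eB.
- exact: sA.
- exact: subsetDl.
- by rewrite (chain_conn chainA).
have cutP i (Y1 Y2 : {set T}) : i <= m -> Y1 \subset G :\: A i ->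
    Y2 \subset G :\: A i ->
    label (Y1 :|: L :&: A i) = label (Y2 :|: L :&: A i) -> twins M (A i) Y1 Y2.
  move=> leim sY1 sY2; have [_ connB connK _] := chain_cut chainA leim.
  have sL := link_sub chainA; have sA0 := chain_subset chainA (leq0n i) leim.
  have sAm := chain_ground chainA (leqnn m).
  apply: (labelP (A i) (G :\: A i)) => //.
  - exact: sA.
  - exact: eB.
  - by have := eB i leim; rewrite inE => /andP[].
  split=> //; last by rewrite connB (chain_conn chainA).
    by clear -sA0; set_dec.
  by clear -sA0 sL sAm; set_dec.
have /fin_all_exists[s sP] : forall j : 'I_m, exists s,
    cut_state M A L label j s.
  move=> j; apply: (cut_state_exists chainA) => //.
  have sj : link_step A L j \subset A j.+1 :\: A j by apply: subsetIr.
  have defU : link_step A L j :|: (A j.+1 :\: A j :\: link_step A L j) =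
      A j.+1 :\: A j by rewrite setDE setUIr setUCr setIT; apply/setUidPr.
  apply: minor_representable; rewrite ?defU //.
  - by apply: subset_trans (subsetDl _ _) _; apply: sA.
  - by rewrite -setI_eq0 setIDA setIC -setIDA setDv setI0.
  - rewrite setD_eq0; have := chain_proper chainA (ltn_ord j).
    by rewrite properE => /andP[].
have s_inj : injective s.
  have lt_neq (i j : 'I_m) : i < j -> s i <> s j.
    move=> ltij eq_s; apply: nF; have := sP i; rewrite eq_s.
    move=> /(equal_states_glue chainA cutP ltij (ltn_ord j)); apply; exact: sP.
  move=> i j eq_s; apply: val_inj; case: (ltngtP i j) => //= lt.
    by case: (lt_neq _ _ lt eq_s).
  by case: (lt_neq _ _ lt (esym eq_s)).
have := leq_card s s_inj; rewrite card_ord => /leq_trans; apply.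
rewrite -cardsT -powersetT card_powerset cardsT leq_pexp2l //.
rewrite !card_prod card_bool -!mulnA leq_mul2l /=.
by apply: leq_mul; apply: leq_trans (card_vspace _) _; rewrite /dim /= mul1n.
Qed.

End Excluded.

Lemma tower_bound q k : 1 < q -> 1 < k ->
  (2 ^ (2 * q ^ (k.-1 * k.-1) * q ^ (k.-1 * k.-1))).+2 ^ k <= q ^ (q ^ (k ^ 6)).
Proof.
move=> q_gt1 k_gt1; have q_gt0 := ltnW q_gt1.
set x := q ^ (k.-1 * k.-1); have x_gt0 : 0 < x by rewrite expn_gt0 q_gt0.
have step1 : (2 ^ (2 * x * x)).+2 <= q ^ (2 * x * x).+1.
  have : 0 < 2 * x * x by rewrite !muln_gt0 x_gt0.
  move: (2 * x * x) => y y_gt0.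
  have le2 : 2 <= 2 ^ y by apply: (@leq_pexp2l 2 1).
  have : 2 ^ y.+1 <= q ^ y.+1 by rewrite leq_exp2r.
  by rewrite (expnS 2); move: le2; clear; lia.
have step2 : (q ^ (2 * x * x).+1) ^ k <= q ^ (q ^ (k ^ 6)).
  rewrite -expnM leq_exp2l //.
  have le1 : (2 * x * x).+1 <= q ^ 2 * (x * x).
    have : 4 <= q ^ 2 by rewrite -[4]/(2 ^ 2) leq_exp2r.
    have : 0 < x * x by rewrite muln_gt0 x_gt0.
    clear; nia.
  have le2 : k <= q ^ k by apply: ltnW; apply: ltn_expl.
  apply: leq_trans (leq_mul le1 le2) _.
  rewrite /x -!expnD leq_exp2l //.
  have k6 : 16 * (k * k) <= k ^ 6.
    rewrite (expnD k 4 2) mulnn leq_mul2r; apply/orP; right.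
    by rewrite -[16]/(2 ^ 4) leq_exp2r.
  apply: leq_trans k6; move: k_gt1; clear; nia.
by apply: leq_trans step2; rewrite leq_exp2r // (ltnW k_gt1).
Qed.

Theorem theorem1p2 (F : finFieldType) (q k : nat) (hq : #|F| = q) (hk : 0 < k)
    (T : finType) (M : matroid T)
    (hM : excluded_minor (@representable F T) M) :
  ~ exists s : seq ({set T} * {set T}),
      size s = tower [:: q; q; k; 6] /\ nested_k_separations M k s.
Proof.
case=> s [size_s /andP[/(all_nthP (set0, set0)) sepS /(sortedP (set0, set0)) nestS]].
have q_gt1 : 1 < q by rewrite -hq card_finRing_gt1.
pose A i := (nth (set0, set0) s i).1.
have sepP i : i < size s ->
    [/\ A i \subset ground M, k <= #|A i|, k <= #|ground M :\: A i| &
        lconn M (A i) (ground M :\: A i) < k].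
  move=> /sepS; rewrite /k_separation -/(A i); set B := snd _.
  case/and5P=> /eqP AB disAB leA leB conn.
  have defB : ground M :\: A i = B.
    by rewrite -AB setDUl setDv set0U; apply/setDidPl; rewrite disjoint_sym.
  rewrite defB; split=> //; first by rewrite -AB subsetUl.
  by rewrite /lconn AB -defB.
have sizeE : size s = q ^ (q ^ (k ^ 6)) by rewrite size_s /tower /= expn1.
(* For k = 1 the sequence is nonempty, and its first member separates [M]. *)
have [k1|k_gt1] := leqP k 1.
  have [|sA leA leB] := sepP 0; first by rewrite sizeE expn_gt0 ltnW.
  rewrite ltnNge; case/negP; apply: leq_trans k1 _.
  apply: (excluded_minor_connected hM); rewrite -?card_gt0.
  - by rewrite -{2}(setID (ground M) (A 0)) (setIidPr sA).
  - by rewrite -setI_eq0 setDE setICA setICr setI0.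
  - exact: leq_trans leA.
  - exact: leq_trans leB.
(* This exceeds the number of states for each connectivity below [k]. *)
set m := (2 ^ (2 * q ^ (k.-1 * k.-1) * q ^ (k.-1 * k.-1))).+1.
have ltN i : i < m.+1 ^ k -> i < size s.
  by move/leq_trans; apply; rewrite sizeE; apply: tower_bound.
have [|||t [X [lttk connX properX subX minX]]] :=
    @tight_subchain T (fun Z => lconn M Z (ground M :\: Z)) m k 0 A.
- by move=> i /ltN; apply: nestS.
- by move=> i /ltN /sepP[].
- by [].
have lt_last : (m.+1 ^ k).-1 < size s by apply: ltN; rewrite prednK // expn_gt0.
have [sAl _ leB _] := sepP _ lt_last.
have sXm : X m \subset ground M by apply: subset_trans subX sAl.
have XA i : i <= m -> X i \subset X m.
  move=> leim; have : m <= m by []; rewrite -{1 3}(subnKC leim).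
  elim: (m - i) => [|j IHj]; first by rewrite addn0.
  rewrite addnS => ltj; apply: subset_trans (IHj (ltnW ltj)) _.
  exact: proper_sub (properX _ ltj).
have sX0 := XA 0 (leq0n m).
have groundE (Z : {set T}) : Z \subset ground M -> Z :|: (ground M :\: Z) = ground M.
  by move=> sZ; set_dec.
have [||||L [sL connL]] := @tutte_linking T M (X 0) (ground M :\: X m) t.
- exact: subset_trans sX0 sXm.
- exact: subsetDl.
- by rewrite disjoint_sym -setI_eq0 -subset0; set_dec.
- move=> Z sZ Zs; have sZX : Z \subset X m by clear -Zs; set_dec.
  have := minX Z sZ sZX; have := lconnK M Z (ground M :\: Z).
  rewrite groundE; first by clear; lia.
  exact: subset_trans sZX sXm.
have chainX : linked_chain M X m L t.
  split=> //.
  - by move=> i /XA sX; apply: subset_trans sX sXm.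
  - by clear -sL sX0 sXm; set_dec.
have ltm : m <= 2 ^ (2 * #|F| ^ (t * t) * #|F| ^ (t * t)).
  apply: (linked_chain_bound hM chainX); rewrite -card_gt0.
  apply: leq_trans hk (leq_trans leB _); apply: subset_leq_card.
  exact: setDS.
move: ltm; rewrite leqNgt; case/negP.
rewrite ltnS leq_exp2l // hq -!mulnA leq_mul2l /= -!expnD leq_exp2l //.
have let' : t <= k.-1 by move: lttk; clear; lia.
by rewrite !leq_add ?leq_mul.
Qed.
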